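(* Let $q,k\in\mathbb N_1$, $\mathbf n\in\mathbb N_0^q$, $\mathbf s_1,\dots,\mathbf s_q,\boldsymbol\alpha\in\mathbb R^k$, and $\mathbf S=(\mathbf s_1,\dots,\mathbf s_q)\in\mathbb R^{k\times q}$. Then $$\mathscr Z^{(q)}_{\mathbf n}[\mathbf S;\boldsymbol\alpha]=Z^{(q)}_{\mathbf n}\big(\Omega_{\mathbf n}[\mathbf S;\boldsymbol\alpha]\big)=\frac1{|\mathbf n|!}\sum_{A\vDash\mathbf n}M(A)\prod_{\mathbf a\in\mathrm{supp}A}\Big((\mathbf s_1^{\diamond a_1}\diamond\cdots\diamond\mathbf s_q^{\diamond a_q})\cdot\boldsymbol\alpha\Big)^{A(\mathbf a)} .$$
   Context: Notation: $\mathbb N_1=\{1,2,\dots\}$, $\mathbb N_0=\{0,1,\dots\}$, $[n]=\{1,\dots,n\}$, $\mathbb N^q_*=\mathbb N_0^q\setminus\{\mathbf 0\}$, $0^0=1$; $|\mathbf a|=\sum_ja_j$, $\mathbf n!=\prod_jn_j!$, $\binom{|\mathbf a|}{\mathbf a}=|\mathbf a|!/\mathbf a!$. For vectors in $\mathbb R^k$, $\diamond$ is the entrywise product, $\mathbf s^{\diamond m}$ the entrywise $m$-th power, $\cdot$ the scalar product. A $q$-chromatic partition $A\vDash\mathbf n$ is a finitely supported map $A\colon\mathbb N^q_*\to\mathbb N_0$ with $\sum_{\mathbf a}A(\mathbf a)\,\mathbf a=\mathbf n$. Its multinomial coefficient is $M(A)=\mathbf n!\prod_{\mathbf a\in\mathrm{supp}A}\frac{\binom{|\mathbf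 a|}{\mathbf a}^{A(\mathbf a)}}{|\mathbf a|^{A(\mathbf a)}A(\mathbf a)!}$. The $q$-chromatic cycle index polynomial is $Z^{(q)}_{\mathbf n}(\mathbf t)=\frac1{|\mathbf n|!}\sum_{A\vDash\mathbf n}M(A)\prod_{\mathbf a\in\mathrm{supp}A}t_{\mathbf a}^{A(\mathbf a)}$ for $\mathbf t=(t_{\mathbf a})_{\mathbf a\le\mathbf n}$ (coordinatewise order), $Z^{(q)}_{\mathbf 0}=1$. Set $\omega_{\mathbf a}[\mathbf S;\boldsymbol\alpha]=(\mathbf s_1^{\diamond a_1}\diamond\cdots\diamond\mathbf s_q^{\diamond a_q})\cdot\boldsymbol\alpha$, $\Omega_{\mathbf n}[\mathbf S;\boldsymbol\alpha]=(\omega_{\mathbf a}[\mathbf S;\boldsymbol\alpha])_{\mathbf a\le\mathbf n}$, and $w[\mathbf S;\boldsymbol\alpha](A)=\prod_{\mathbf a\in\mathrm{supp}A}\omega_{\mathbf a}[\mathbf S;\boldsymbol\alpha]^{A(\mathbf a)}$. Fix an $\mathbf n$-coloring, i.e. a map $[|\mathbf n|]\to[q]$ with exactly $n_j$ elements of color $j$ for each $j\in[q]$. For a permutation $\pi$ of $[|\mathbf n|]$, $\mathsf{color}(\pi)$ is the $q$-chromatic partition $A_\pi\vDash\mathbf n$ where $A_\pi(\mathbf a)$ is the number of cycles of $\pi$ (including fixed points) containing, for each $j$, exactly $a_j$ elements of color $j$. The pattern inventory is $\mathscr Z^{(q)}_{\mathbf n}[\mathbf S;\boldsymbol\alpha]=\frac1{|\mathbf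 n|!}\sum_{\pi\in\mathfrak S_{|\mathbf n|}}w[\mathbf S;\boldsymbol\alpha](\mathsf{color}(\pi))$, with $\mathfrak S_n$ the symmetric group on $[n]$. *)

(* Defs.v *)
From mathcomp Require Import all_boot all_order all_algebra all_fingroup.
From mathcomp Require Import finmap.
From mathcomp Require Import boolp classical_sets functions cardinality fsbigop.
From mathcomp Require Import reals.

Set Implicit Arguments.
Unset Strict Implicit.
Unset Printing Implicit Defensive.

Import Order.TTheory GRing.Theory Num.Theory.
Local Open Scope ring_scope.

Notation mindex q := {ffun 'I_q -> nat}.
Notation mindex_nz q := {a : mindex q | a != 0}.
Notation chromatic_map q := {fsfun mindex_nz q -> nat with 0%N}.

Section MultiIndex.
Variable q : nat.
Implicit Types a n : mindex q.

Definition mabs a : nat := (\sum_(j < q) a j)%N.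
Definition mfact a : nat := (\prod_(j < q) (a j)`!)%N.
Definition mle a n : bool := [forall j, (a j <= n j)%N].

Definition multinomial (R : realType) a : R := (mabs a)`!%:R / (mfact a)%:R.

End MultiIndex.

Section Vectors.
Variables (R : realType) (k : nat).
Implicit Types u v : 'cV[R]_k.

Definition hadamard u v : 'cV[R]_k := map2_mx *%R u v.
Definition hadamard_exp u (m : nat) : 'cV[R]_k := map_mx (fun x => x ^+ m) u.
Definition dot u v : R := \sum_(i < k) u i 0 * v i 0.

End Vectors.

Section Partitions.
Variable q : nat.
Implicit Types (n : mindex q) (A : chromatic_map q).

(** [chromatic_partitions n A] is A |= n; the sum and [*+] of multi-indices
    are entrywise. *)
Definition chromatic_partitions n : set (chromatic_map q) :=
  fun A => \sum_(a <- finsupp A) val a *+ A a = n.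

Lemma chromatic_partitions_mul n A (a : mindex_nz q) (j : 'I_q) :
  chromatic_partitions n A -> (val a j * A a <= n j)%N.
Proof.
move=> <-; case: (finsuppP A a) => [|aA]; first by rewrite muln0.
rewrite sum_ffunE (big_fsetD1 a) //= ffunMnE.
rewrite -mulr_natr natn; exact: leq_addr.
Qed.

Lemma chromatic_partitions_mle n A (a : mindex_nz q) :
  chromatic_partitions n A -> a \in finsupp A -> mle (val a) n.
Proof.
move=> nA aA; apply/forallP => j; apply: leq_trans (chromatic_partitions_mul a j nA).
by apply: leq_pmulr; rewrite lt0n -mem_finsupp.
Qed.

(** Sums over A |= n are written [\sum_(A \in chromatic_partitions n)]; that
    operator would return 0 if infinitely many terms were nonzero. *)
Lemma chromatic_partitions_finite n : finite_set (chromatic_partitions n).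
Proof.
pose N := mabs n.
have leN j : (n j <= N)%N by rewrite /N /mabs (bigD1 j) //= leq_addr.
pose box : seq (mindex_nz q) :=
  pmap insub [seq [ffun j => val (g j)] | g : {ffun 'I_q -> 'I_N.+1}].
pose U : {fset mindex_nz q * nat} :=
  [fset x in [seq (a, m) | a <- box, m <- iota 0 N.+1]]%fset.
pose graph A : {fset mindex_nz q * nat} := [fset (a, A a) | a in finsupp A]%fset.
have graph_inj : injective graph.
  have sub A B a : graph A = graph B -> a \in finsupp A -> B a = A a.
    move=> AB aA; have : (a, A a) \in graph A by apply/imfsetP; exists a.
    by rewrite AB => /imfsetP[b _ [-> ->]].
  move=> A B AB; apply/fsfunP => a.
  have [aA|aA] := boolP (a \in finsupp A); first by rewrite (sub A B).
  have [aB|aB] := boolP (a \in finsupp B); first by rewrite (sub B A).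
  by rewrite !fsfun_dflt.
have fin : finite_set (graph @^-1` [set` fpowerset U]).
  by apply: finite_preimage => // A B _ _; exact: graph_inj.
apply: sub_finite_set fin => A nA; rewrite /preimage /= fpowersetE.
apply/fsubsetP => _ /imfsetP[a /= aA ->]; rewrite in_fset.
have aN j : (val a j <= N)%N.
  exact: leq_trans (forallP (chromatic_partitions_mle nA aA) j) (leN j).
apply: allpairs_f.
  rewrite mem_pmap; apply/mapP; exists (val a); last by rewrite valK.
  apply/mapP; exists [ffun j => inord (val a j)]; first by rewrite mem_enum.
  by apply/ffunP => j; rewrite !ffunE /= inordK // ltnS.
rewrite mem_iota add0n ltnS /=.
have /existsP[j aj] : [exists j, val a j != 0%N].
  apply: contraT; rewrite negb_exists => /forallP a0.
  case/negP: (valP a); apply/eqP/ffunP => j; rewrite ffunE.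
  by apply/eqP; move/negPn: (a0 j).
apply: leq_trans (leN j); apply: leq_trans (chromatic_partitions_mul a j nA).
by rewrite leq_pmull // lt0n.
Qed.

(** The multinomial coefficient M(A) of A |= n. *)
Definition chromatic_coef (R : realType) n A : R :=
  (mfact n)%:R *
  \prod_(a <- finsupp A)
    (multinomial R (val a) ^+ A a / ((mabs (val a))%:R ^+ A a * (A a)`!%:R)).

(** The cycle index polynomial as a function of the family (t_a)_{a <= n};
    by [chromatic_partitions_mle] the default value 0 is never used. *)
Definition cycle_index (R : realType) n (t : {a : mindex q | mle a n} -> R) : R :=
  (mabs n)`!%:R^-1 *
  \sum_(A \in chromatic_partitions n)
    chromatic_coef R n A *
    \prod_(a <- finsupp A) (oapp t 0 (insub (val a))) ^+ A a.

Lemma cycle_index0 (R : realType) t : @cycle_index R 0 t = 1.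
Proof.
rewrite /cycle_index; have -> : chromatic_partitions 0 = [set [fsfun]]%classic.
  apply/seteqP; split=> [A nA|_ ->] /=; last first.
    by rewrite /chromatic_partitions finsupp0 big_seq_fset0.
  apply/fsfunP => a; rewrite fsfun0E; apply: contraNeq (valP a) => Aa.
  apply/eqP/ffunP => j; have := chromatic_partitions_mul a j nA.
  by rewrite ffunE leqn0 muln_eq0 (negPf Aa) orbF => /eqP.
rewrite fsbig_set1 /chromatic_coef finsupp0 !big_seq_fset0 !mulr1.
rewrite /mabs /mfact big1 ?big1 ?fact0 ?invr1 ?mulr1 // => j _.
  by rewrite ffunE.
by rewrite ffunE.
Qed.

End Partitions.

Section Weights.
Variables (R : realType) (q k : nat).
Variables (S : 'M[R]_(k, q)) (alpha : 'cV[R]_k).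

Definition omega (a : mindex q) : R :=
  dot (\big[@hadamard R k/const_mx 1]_(j < q) hadamard_exp (col j S) (a j)) alpha.

Definition Omega (n : mindex q) (a : {a : mindex q | mle a n}) : R :=
  omega (val a).

Definition weight (A : chromatic_map q) : R :=
  \prod_(a <- finsupp A) omega (val a) ^+ A a.

End Weights.

Arguments cycle_index {q R} n t.
Arguments Omega {R q k} S alpha n a.

Section Color.
Variables (q : nat) (n : mindex q).

Definition is_coloring (c : {ffun 'I_(mabs n) -> 'I_q}) : Prop :=
  forall j, #|[set i | c i == j]| = n j.

Variable c : {ffun 'I_(mabs n) -> 'I_q}.

Definition color_content (C : {set 'I_(mabs n)}) : mindex q :=
  [ffun j => #|[set i in C | c i == j]|].

(** [porbits p] is the set of cycles of [p], fixed points included. The finite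
    set given to [fsfun] only makes the support finite, see [colorE]. *)
Definition color (p : {perm 'I_(mabs n)}) : chromatic_map q :=
  [fsfun a in seq_fset tt (pmap insub [seq color_content C | C in porbits p])
     => #|[set C in porbits p | color_content C == val a]|].

Lemma colorE p a :
  color p a = #|[set C in porbits p | color_content C == val a]|.
Proof.
rewrite fsfun_fun seq_fsetE mem_pmap; case: ifPn => // aN.
apply/esym/eqP; rewrite cards_eq0 -finset.subset0; apply/fintype.subsetP => C.
rewrite !inE => /andP[Cp /eqP Ca]; case/negP: aN; apply/mapP.
by exists (val a); rewrite ?valK // -Ca; exact: fintype.image_f.
Qed.

Definition pattern_inventory (R : realType) (k : nat)
    (S : 'M[R]_(k, q)) (alpha : 'cV[R]_k) : R :=
  (mabs n)`!%:R^-1 * \sum_(p : {perm 'I_(mabs n)}) weight S alpha (color p).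

End Color.

(* Main.v *)
Require Import Defs.
From mathcomp Require Import all_boot all_order all_algebra all_fingroup.
From mathcomp Require Import finmap.
From mathcomp Require Import boolp classical_sets functions cardinality fsbigop.
From mathcomp Require Import reals ring.

(** Sorting the permutations of [|n|] by their colour type turns the pattern
    inventory into a sum over A |= n, so the theorem says that exactly M(A)
    permutations have colour type A.

    This is proved for the permutations supported in an arbitrary subset D of
    the coloured points, where n is the colour content of D, by induction on D
    ([card_colored_perms]). Choose a in the support of A and count the pairs
    (p, C) where p has colour type A and C is a cycle of p of content a. Each p
    lies in A(a) such pairs. On the other hand, C is one of the
    prod_j binom(n_j, a_j) subsets of D of content a ([card_color_content]),
    and p is a full cycle on C times a permutation of D minus C whose colour
    type is A with one copy of a removed ([card_glue_cycle],
    [has_colors_remove]). There are (|a| - 1)! full cycles on C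
    ([card_full_cycles]), hence, with N the number of permutations of a given
    colour type,
      A(a) N(n, A) = prod_j binom(n_j, a_j) (|a| - 1)! N(n - a, A - [a]).
    The coefficients M satisfy the same recursion ([chromatic_coef_remove]),
    and both sides are 1 when A = 0. *)

Set Implicit Arguments.
Unset Strict Implicit.
Unset Printing Implicit Defensive.

Import GRing.Theory Num.Theory.

Local Open Scope ring_scope.

(** * Permutations with a prescribed cycle *)

Section Cycles.
Variable T : finType.
Implicit Types (p z : {perm T}) (C D : {set T}) (x : T).

Lemma eq_porbit p z x :
  {in porbit p x, p =1 z} -> porbit z x = porbit p x.
Proof.
move=> pz; have E i : (z ^+ i)%g x = (p ^+ i)%g x.
  elim: i => [|i IHi]; first by rewrite !expg0.
  by rewrite !expgSr !permM IHi pz // mem_porbit.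
by apply/setP=> y; apply/porbitP/porbitP=> -[i ->]; exists i; rewrite E.
Qed.

Lemma porbit_sub D p x : p \in Sym D -> x \in D -> porbit p x \subset D.
Proof.
rewrite inE => pD xD; apply/fintype.subsetP => _ /porbitP[i ->].
by elim: i => [|i IHi]; rewrite ?expg0 ?perm1 // expgSr permM perm_closed.
Qed.

Lemma Sym_sub D (E : {set T}) p : D \subset E -> p \in Sym D -> p \in Sym E.
Proof. by move=> DE; rewrite !inE => /fintype.subset_trans; apply. Qed.

Definition full_cycles C := [set p in Sym C | C \in porbits p].

Lemma full_cyclesP C p x :
  p \in full_cycles C -> x \in C -> porbit p x = C.
Proof.
rewrite inE => /andP[_ /imsetP[y _ ->]] xy.
by apply/eqP; rewrite eq_porbit_mem.
Qed.

(** Once a starting point x in C is fixed, a full cycle is the same thing as the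
    order in which it visits the other points of C. *)
Lemma card_full_cycles C x : x \in C -> #|full_cycles C| = (#|C|.-1)`!.
Proof.
move=> xC; set m := #|C|.-1.
have Cm : #|C| = m.+1 by rewrite prednK // (cardD1 x) xC.
pose U := [set t : m.-tuple T | all (mem (C :\ x)) t & uniq t].
pose G p : m.-tuple T :=
  Tuple (introT eqP (size_traject p (p x) m)).
have cardU : #|U| = m`!.
  rewrite card_uniq_tuples -ffactnn; congr (_ ^_ _)%N.
  by move: Cm; rewrite (cardsD1 x) xC => -[].
rewrite -cardU; have <- : G @: full_cycles C = U.
  apply/setP=> t; rewrite inE; apply/imsetP/andP=> [[p pC ->]|[tC ut]].
    have pxC := full_cyclesP pC xC.
    have := uniq_traject_porbit p x; rewrite pxC Cm /= => /andP[xN ->]; split=> //.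
    apply/allP=> y ty; rewrite !inE; apply/andP; split.
      by apply: contraTneq ty => ->.
    by rewrite -pxC porbit_traject pxC Cm /= inE ty orbT.
  have us : uniq (x :: t).
    by rewrite /= ut andbT; apply/negP => /(allP tC); rewrite !inE eqxx.
  have sC : x :: t =i C.
    apply/subset_cardP; first by rewrite (card_uniqP us) /= size_tuple Cm.
    apply/fintype.subsetP=> y; rewrite inE => /predU1P[-> //|/(allP tC)].
    by rewrite !inE => /andP[].
  (* The full cycle that visits t in order: [next] is the identity off the
     list. *)
  pose p := perm (can_inj (prev_next us)).
  have pE : p =1 next (x :: t) by move=> y; rewrite permE.
  have pt : t = traject p (p x) m :> seq T.
    have := cycle_next us; rewrite -(eq_fcycle pE) /= rcons_path => /andP[+ _].
    by move/fpathE; rewrite size_tuple.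
  have pS : p \in Sym C.
    rewrite inE; apply/fintype.subsetP=> y; rewrite inE pE -sC.
    by apply: contraR => yN; rewrite next_nth (negPf yN).
  exists p; last exact: val_inj.
  rewrite inE pS; apply/imsetP; exists x => //; apply/eqP.
  rewrite finset.eqEsubset porbit_sub // andbT; apply/fintype.subsetP=> y.
  rewrite -sC pt -[x :: _]/(traject p x m.+1) => /trajectP[i _ ->].
  by rewrite -permX mem_porbit.
rewrite card_in_imset // => p r pC rC /(congr1 val) /= prE.
have pxC := full_cyclesP pC xC; have rxC := full_cyclesP rC xC.
have prI i : (i <= m)%N -> iter i p x = iter i r x.
  move=> im; have: nth x (traject p x m.+1) i = nth x (traject r x m.+1) i.
    by rewrite /= prE.
  by rewrite !nth_traject.
have := pC; have := rC; rewrite !inE => /andP[rS _] /andP[pS _].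
apply/permP=> y; have [yC|yN] := boolP (y \in C); last first.
  by rewrite (out_perm pS) ?(out_perm rS).
have: y \in porbit p x by rewrite pxC.
rewrite porbit_traject pxC Cm => /trajectP[i im ->].
rewrite -iterS [in RHS]prI // -iterS.
move: im; rewrite ltnS leq_eqVlt => /predU1P[->|]; last exact: prI.
by rewrite -Cm -{1}pxC iter_porbit -rxC iter_porbit.
Qed.

Lemma mul_cycleE C p z x :
  z \in Sym C -> p \in Sym (~: C) -> (z * p)%g x = if x \in C then z x else p x.
Proof.
rewrite !inE => zC pC; rewrite permM; case: ifP => xC.
  by rewrite (out_perm pC) // inE negbK perm_closed.
by rewrite (out_perm zC) ?xC.
Qed.

(** The two factors move disjoint sets of points, so each of them keeps its own
    cycles in the product. *)
Lemma cycles_mul_cycle C D p z :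
  C \subset D -> z \in full_cycles C -> p \in Sym (D :\: C) ->
  porbit (z * p)%g @: D = C |: porbit p @: (D :\: C).
Proof.
move=> CD zC pDC.
have zS : z \in Sym C by move: zC; rewrite inE => /andP[].
have pS : p \in Sym (~: C).
  by apply: Sym_sub pDC; apply/fintype.subsetP=> y; rewrite !inE => /andP[].
have zpC : {in C, porbit (z * p)%g =1 fun=> C}.
  move=> x xC; rewrite -[RHS](full_cyclesP zC xC); apply: eq_porbit => y.
  by rewrite (full_cyclesP zC xC) (mul_cycleE _ zS pS) => ->.
have zpD : {in D :\: C, porbit (z * p)%g =1 porbit p}.
  move=> x xDC; apply: eq_porbit => y /(fintype.subsetP (porbit_sub pDC xDC)).
  by rewrite (mul_cycleE _ zS pS) !inE => /andP[/negPf->].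
rewrite -{1}(finset.setID D C) (finset.setIidPr CD) imsetU (eq_in_imset zpD).
congr (_ :|: _); rewrite (eq_in_imset zpC); apply/setP=> X; rewrite inE.
apply/imsetP/eqP => [[x _ ->]//|->].
move: zC; rewrite inE => /andP[_ /imsetP[x _ Cx]].
by exists x; rewrite // Cx porbit_id.
Qed.

Lemma cycle_notin C D p : C \notin porbit p @: (D :\: C).
Proof. by apply/imsetP=> -[x + CE]; rewrite inE {1}CE porbit_id. Qed.

(** Cutting out a cycle: p with cycle C factors uniquely as its restriction to C
    times a permutation of D minus C. Since C leaves the set of cycles and
    nothing else changes there, any condition P on the remaining cycles becomes
    a condition on the second factor. *)
Lemma card_glue_cycle C D (P : pred {set {set T}}) :
  C \subset D ->
  #|[set p in Sym D | C \in porbit p @: D & P (porbit p @: D :\ C)]| =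
  (#|full_cycles C| * #|[set p in Sym (D :\: C) | P (porbit p @: (D :\: C))]|)%N.
Proof.
move=> CD; rewrite -cardsX.
set X := finset.setX _ _.
pose mul (zp : {perm T} * {perm T}) := (zp.1 * zp.2)%g.
have SymC p : p \in Sym (D :\: C) -> p \in Sym (~: C).
  by apply: Sym_sub; apply/fintype.subsetP=> y; rewrite !inE => /andP[].
have inX z p : (z, p) \in X -> [/\ z \in full_cycles C, z \in Sym C,
    p \in Sym (D :\: C), p \in Sym (~: C) & P (porbit p @: (D :\: C))].
  rewrite finset.in_setX => /andP[/= zC]; rewrite inE => /andP[pDC Pp]; split=> //.
    by move: zC; rewrite inE => /andP[].
  exact: SymC.
rewrite -(@card_in_imset _ _ mul X); last first.
  move=> [z p] [z' p'] /inX[_ zC _ pC _] /inX[_ zC' _ pC' _]; rewrite /mul /= => E.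
  have zE : z = z'.
    apply/permP=> x; have := congr1 (fun r : {perm T} => r x) E.
    rewrite !(@mul_cycleE C) //; case: ifP => // xC _.
    by move: zC zC'; rewrite !inE => zC zC'; rewrite !(@out_perm _ C) ?xC.
  by congr (_, _) => //; apply: (mulgI z); rewrite {2}zE.
congr #|pred_of_set _|; apply/setP=> r; rewrite inE.
apply/and3P/imsetP => [[rD Cr Pr]|[[z p] /inX[zF zC pDC pC Pp] ->]]; last first.
  rewrite /mul /= (cycles_mul_cycle CD) // setU11 finset.setU1K ?cycle_notin //.
  by split=> //; rewrite groupM ?(Sym_sub CD zC) ?(Sym_sub _ pDC) ?finset.subsetDl.
have rC x : x \in C -> porbit r x = C.
  by case/imsetP: Cr => y _ -> xy; apply/eqP; rewrite eq_porbit_mem.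
have rCC x : x \in C -> r x \in C.
  by move=> xC; rewrite -(rC x xC) -[r]expg1 mem_porbit.
have rN : r \in ('N(C | 'P))%g.
  rewrite inE finset.in_setT inE.
  by apply/fintype.subsetP=> x xC; rewrite inE /= apermE rCC.
pose z := restr_perm C r; pose p := (z^-1 * r)%g.
have zr : {in C, z =1 r} by move=> x xC; exact: restr_permE.
have zF : z \in full_cycles C.
  rewrite inE inE restr_perm_on /=; case/imsetP: Cr => y yD Cy.
  have yC : y \in C by rewrite Cy porbit_id.
  apply/imsetP; exists y => //; rewrite (@eq_porbit r) // -Cy.
  by move=> x /zr.
have zS : perm_on C z := restr_perm_on C r.
have pDC : p \in Sym (D :\: C).
  rewrite inE; apply/fintype.subsetP=> x; rewrite inE /p permM => px.
  rewrite inE; apply/andP; split.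
    apply: contraNN px => xC; rewrite -zr ?permKV //.
    by rewrite perm_closed // perm_onV.
  apply: contraNT px => xD; rewrite inE in rD.
  have xC : x \notin C by apply: contraNN xD; exact: fintype.subsetP.
  by rewrite (out_perm (perm_onV zS)) // (out_perm rD).
have rE : r = (z * p)%g by rewrite mulKVg.
exists (z, p) => //; rewrite finset.in_setX zF inE pDC /=.
by move: Pr; rewrite rE (cycles_mul_cycle CD) // finset.setU1K // cycle_notin.
Qed.

Lemma porbitsT p : porbits p = porbit p @: [set: T].
Proof. by apply/setP=> C; apply/imsetP/imsetP => -[x _ ->]; exists x. Qed.

End Cycles.

(** * Removing a part from a chromatic partition *)

(** Pulling out one index a, even when it lies outside the support: a zero
    exponent contributes [idx]. *)
Lemma big_finsupp (K : choiceType) (V : Type) (idx : V)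
    (op : Monoid.com_law idx) (A : {fsfun K -> nat with 0%N})
    (F : K -> nat -> V) (a : K) :
  F a 0%N = idx ->
  \big[op/idx]_(b <- finsupp A) F b (A b) =
  op (F a (A a)) (\big[op/idx]_(b <- (finsupp A `\ a)%fset) F b (A b)).
Proof.
move=> F0; have [aA|aN] := boolP (a \in finsupp A); first exact: big_fsetD1.
by rewrite (fsfun_dflt aN) F0 Monoid.mul1m mem_fsetD1.
Qed.

Lemma mindex_addI q (u : mindex q) : injective (+%R u).
Proof.
move=> v w /ffunP E; apply/ffunP=> j; have := E j.
by rewrite !ffunE; apply: addnI.
Qed.

Section Remove.
Variable q : nat.
Implicit Types (A : chromatic_map q) (a : mindex_nz q).

Definition remove a A : chromatic_map q := [fsfun A with a |-> (A a).-1].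

Lemma big_remove (V : Type) (idx : V) (op : Monoid.com_law idx)
    (F : mindex_nz q -> nat -> V) a A :
  \big[op/idx]_(b <- (finsupp (remove a A) `\ a)%fset) F b (remove a A b) =
  \big[op/idx]_(b <- (finsupp A `\ a)%fset) F b (A b).
Proof.
have -> : (finsupp (remove a A) `\ a = finsupp A `\ a)%fset.
  by apply/fsetP=> b; rewrite !inE !mem_finsupp fsfun_withE; case: eqP.
rewrite !big_seq; apply: eq_bigr => b; rewrite !inE fsfun_withE.
by move=> /andP[/negPf-> _].
Qed.

Lemma chromatic_partitions_remove (m : mindex q) A a :
  (0 < A a)%N -> chromatic_partitions (val a + m) A ->
  chromatic_partitions m (remove a A).
Proof.
move=> Aa; rewrite /chromatic_partitions.
rewrite !(@big_finsupp _ _ _ _ _ (fun b k => val b *+ k) a) //=.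
rewrite /= (@big_remove _ _ _ (fun b k => val b *+ k)) fsfun_with -{1}(prednK Aa) mulrS -addrA => E.
by apply: (@mindex_addI _ (val a)); rewrite -E.
Qed.

(** In the product defining M(A) only the factor at a changes, by
    (|a|! / a!) / (|a| A(a)); in front of the product, the binomials times
    a! m! make (a + m)!. *)
Lemma chromatic_coef_remove (R : realType) (m : mindex q) A a :
  (0 < A a)%N ->
  (A a)%:R * chromatic_coef R (val a + m) A =
  (\prod_j 'C((val a + m)%R j, val a j))%:R * (mabs (val a)).-1`!%:R
  * chromatic_coef R m (remove a A).
Proof.
move=> Aa.
pose f := fun (b : mindex_nz q) k =>
  multinomial R (val b) ^+ k / ((mabs (val b))%:R ^+ k * k`!%:R).
have a0 : (0 < mabs (val a))%N.
  rewrite lt0n; apply: contraNneq (valP a) => /eqP.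
  rewrite /mabs sum_nat_eq0 => /forallP a0; apply/eqP/ffunP=> j.
  by rewrite ffunE; apply/eqP; exact: (a0 j).
have f0 : f a 0%N = 1 by rewrite /f !expr0 fact0 !(mulr1, invr1).
have fS k : f a k.+1 =
    f a k * (multinomial R (val a) / ((mabs (val a))%:R * k.+1%:R)).
  rewrite /f !exprS factS natrM; field.
  by rewrite nat1r !pnatr_eq0 expf_neq0 ?pnatr_eq0 -!lt0n ?fact_gt0 ?a0.
have coefE k B : chromatic_coef R k B =
  (mfact k)%:R * \prod_(b <- finsupp B) f b (B b) by [].
move: f coefE f0 fS => f coefE f0 fS; rewrite !coefE !(@big_finsupp _ _ _ _ _ f a) //.
rewrite (@big_remove _ _ _ f) fsfun_with.
set P := \prod_(b <- _) _; rewrite !mulrA; congr (_ * P).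
have mfE : (\prod_j 'C((val a + m)%R j, val a j) * mfact (val a) * mfact m
    = mfact (val a + m)%R)%N.
  rewrite /mfact -!big_split; apply: eq_bigr => j _ /=.
  by rewrite !ffunE -(@bin_fact (val a j + m j) (val a j)) ?leq_addr // addKn mulnA.
case: (A a) Aa => // k _; rewrite [k.+1.-1]/=.
have absE : ((mabs (val a))`! = mabs (val a) * (mabs (val a)).-1`!)%N.
  by case: (mabs (val a)) a0 => // l _; rewrite factS.
rewrite fS -mfE !natrM /multinomial absE natrM.
field.
by rewrite nat1r !pnatr_eq0 -!lt0n a0 /mfact prodn_gt0 // => j; rewrite fact_gt0.
Qed.

End Remove.

(** * Colour contents *)

(** Choosing C amounts to choosing its part of each colour separately. *)
Lemma card_subset_colors (T : finType) q (c : T -> 'I_q) (D : {set T})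
    (a : 'I_q -> nat) :
  #|[set C : {set T} | C \subset D & [forall j, #|[set i in C | c i == j]| == a j]]|
  = (\prod_j 'C(#|[set i in D | c i == j]|, a j))%N.
Proof.
pose F j : pred {set T} :=
  [pred B : {set T} | B \subset [set i in D | c i == j] & #|B| == a j].
have -> : (\prod_j 'C(#|[set i in D | c i == j]|, a j))%N
        = #|(family F : simpl_pred {ffun 'I_q -> {set T}})|.
  rewrite card_family /image_mem foldrE big_map big_enum /=.
  by apply: eq_bigr => j _; rewrite -cards_draws; apply: eq_card => B; rewrite inE.
pose split (C : {set T}) := [ffun j : 'I_q => [set i in C | c i == j]].
rewrite -(@card_imset _ _ split); last first.
  move=> B C /ffunP E; apply/setP=> i.
  by have /setP/(_ i) := E (c i); rewrite !ffunE !inE eqxx !andbT.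
apply: eq_card => f; apply/imsetP/familyP => [[C + ->] j|fF].
  rewrite inE => /andP[CD /forallP/(_ j) Cj].
  rewrite ffunE /F inE /= Cj andbT; apply/fintype.subsetP=> i.
  by rewrite !inE => /andP[/(fintype.subsetP CD) -> ->].
have fD j i : i \in f j -> (i \in D) && (c i == j).
  have := fF j; rewrite /F inE => /andP[/fintype.subsetP fj _] /fj.
  by rewrite inE.
have fE j : [set i in [set i | i \in f (c i)] | c i == j] = f j.
  apply/setP=> i; rewrite !inE; apply/andP/idP => [[? /eqP<-//]|fi].
  by have /andP[_ /eqP cj] := fD _ _ fi; rewrite cj.
exists [set i | i \in f (c i)]; last by apply/ffunP=> j; rewrite ffunE fE.
rewrite inE; apply/andP; split.
  by apply/fintype.subsetP=> i; rewrite inE => /fD/andP[].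
apply/forallP=> j; rewrite fE.
by have := fF j; rewrite /F inE => /andP[].
Qed.

Section Coloring.
Variables (q : nat) (n : mindex q) (c : {ffun 'I_(mabs n) -> 'I_q}).
Implicit Types (C D : {set 'I_(mabs n)}) (X : {set {set 'I_(mabs n)}}).
Implicit Types (A : chromatic_map q) (a : mindex_nz q).

Notation content := (color_content c).

Lemma color_contentU C D :
  [disjoint C & D] -> content (C :|: D) = content C + content D.
Proof.
move=> CD; apply/ffunP=> j; rewrite !ffunE -[RHS]/(_ + _)%N -cardsUI.
have -> : [set i in C | c i == j] :&: [set i in D | c i == j] = finset.set0.
  apply/setP=> i; rewrite !inE; have [iC|] //= := boolP (i \in C).
  by rewrite (disjointFr CD) ?andbF.
rewrite cards0 addn0; congr #|pred_of_set _|.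
by apply/setP=> i; rewrite !inE andb_orl.
Qed.

Lemma mabs_color_content C : mabs (content C) = #|C|.
Proof.
rewrite -sum1_card (partition_big c predT) //=; apply: eq_bigr => j _.
by rewrite ffunE -sum1_card; apply: eq_bigl => i; rewrite inE.
Qed.

Lemma color_content_eq0 C : (content C == 0) = (C == finset.set0).
Proof.
apply/eqP/eqP => [C0|->].
  apply/eqP; rewrite -cards_eq0 -mabs_color_content C0 /mabs.
  by rewrite big1 // => j _; rewrite ffunE.
by apply/ffunP=> j; rewrite !ffunE; apply: eq_card0 => i; rewrite !inE.
Qed.

Lemma card_color_content D (a : mindex q) :
  #|[set C : {set 'I_(mabs n)} | C \subset D & content C == a]|
  = (\prod_j 'C(content D j, a j))%N.
Proof.
have -> : (\prod_j 'C(content D j, a j))%N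
  = (\prod_j 'C(#|[set i in D | c i == j]|, a j))%N.
  by apply: eq_bigr => j _; rewrite ffunE.
rewrite -card_subset_colors; apply: eq_card => C; rewrite !inE; congr (_ && _).
by apply/eqP/forallP => [<- j|H]; [|apply/ffunP=> j; apply/eqP]; rewrite ffunE.
Qed.

Definition has_colors X A :=
  forall a, A a = #|[set C in X | content C == val a]|.

Lemma color_eq p A : color c p = A <-> has_colors (porbits p) A.
Proof.
split=> [<- a|pA]; first by rewrite colorE.
by apply/fsfunP=> a; rewrite colorE pA.
Qed.

(** Cutting C out of X lowers the number of sets of content a by one and changes
    no other count. *)
Lemma has_colors_remove X A C a :
  C \in X -> content C = val a -> (0 < A a)%N ->
  has_colors X A <-> has_colors (X :\ C) (remove a A).
Proof.
move=> CX Ca Aa.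
have E b : #|[set E in X | content E == val b]| =
    ((b == a) + #|[set E in X :\ C | content E == val b]|)%N.
  rewrite (cardsD1 C) !inE CX Ca (inj_eq val_inj) eq_sym; congr (_ + _)%N.
  by apply: eq_card => B; rewrite !inE andbA.
split=> XA b; [rewrite fsfun_withE|]; have := XA b; rewrite E ?fsfun_withE.
  by case: eqP => [->|_] /= ->.
by case: eqP => [->|_] /= <-; rewrite ?add0n ?add1n ?prednK.
Qed.

(** * Counting permutations by colour type *)

(** Induction on D by double counting the pairs (p, C) with C a cycle of p of
    content a: summing over p first gives A(a) times the cardinal sought, and
    summing over C first gives the recursion of M. *)
Lemma card_colored_perms (R : realType) D A :
  chromatic_partitions (content D) A ->
  #|[set p in Sym D | `[< has_colors (porbit p @: D) A >]]|%:R
  = chromatic_coef R (content D) A.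
Proof.
have [m] := ubnP #|D|; elim: m => // m IHm in D A *; rewrite ltnS => Dm DA.
(* If A = 0, then D is empty and only the identity is counted. *)
have [A0|[a aA]] := fset_0Vmem (finsupp A).
  have A0E a : A a = 0%N by apply: fsfun_dflt; rewrite A0.
  have D0 : D = finset.set0.
    apply/eqP; rewrite -color_content_eq0.
    by rewrite -DA A0 big_seq_fset0.
  rewrite /chromatic_coef A0 big_seq_fset0 mulr1 D0.
  have -> : content finset.set0 = 0 by apply/eqP; rewrite color_content_eq0.
  have -> : mfact (0 : mindex q) = 1%N by rewrite /mfact big1 // => j _; rewrite ffunE.
  rewrite (_ : [set p in _ | _] = [set 1%g]) ?cards1 //.
  apply/setP=> p; rewrite !inE; apply/andP/eqP => [[p0 _]|->].
    by apply: (perm_on_id p0); rewrite cards0.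
  split; first exact: perm_on1.
  apply/asboolP=> a; rewrite A0E; apply/esym/eqP; rewrite cards_eq0.
  by apply/eqP/setP=> C; rewrite imset0 !inE.
have Aa : (0 < A a)%N by rewrite lt0n -mem_finsupp.
pose Xa := [set C : {set 'I_(mabs n)} | C \subset D & content C == val a].
(* m0 is content D - a, the content of what is left after C is cut out. *)
pose m0 : mindex q := [ffun j => content D j - val a j]%N.
pose S := [set p in Sym D | `[< has_colors (porbit p @: D) A >]].
have aD : content D = val a + m0.
  have /forallP leD := chromatic_partitions_mle DA aA.
  apply/ffunP=> j; rewrite [RHS]ffunE /m0 [X in _ + X]ffunE.
  by apply/esym; exact: subnKC.
have count C : C \in Xa ->
    #|[set p in S | C \in porbit p @: D]|%:R
    = ((mabs (val a)).-1)`!%:R * chromatic_coef R m0 (remove a A).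
  rewrite inE => /andP[CD /eqP Ca].
  have cDC : content (D :\: C) = m0.
    apply: (@mindex_addI _ (val a)); rewrite -aD -Ca -color_contentU.
      by rewrite -{1}(finset.setIidPr CD) finset.setID.
    by rewrite finset.disjoints_subset; apply/fintype.subsetP=> i iC; rewrite !inE iC.
  have C0 : C != finset.set0 by rewrite -color_content_eq0 Ca (valP a).
  have /set0Pn[x xC] := C0.
  pose P X := `[< has_colors X (remove a A) >].
  have -> : [set p in S | C \in porbit p @: D] =
     [set p in Sym D | C \in porbit p @: D & P (porbit p @: D :\ C)].
    apply/setP=> p; rewrite !inE -andbA; congr (_ && _).
    rewrite andbC; apply: andb_id2l => Cp; apply: asbool_equiv_eq.
    exact: has_colors_remove.
  rewrite card_glue_cycle // natrM (card_full_cycles xC) -mabs_color_content Ca.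
  rewrite -cDC IHm //.
    apply: leq_trans Dm; apply: proper_card.
    rewrite finset.properEneq finset.subsetDl andbT.
    apply: contraTneq (fintype.subsetP CD _ xC) => <-.
    by rewrite inE xC.
  by apply: chromatic_partitions_remove => //; rewrite cDC -aD.
apply: (@mulfI _ (A a)%:R); first by rewrite pnatr_eq0 -lt0n.
rewrite aD chromatic_coef_remove // -aD -card_color_content -/Xa -/S.
rewrite -mulrA -natrM mulr_natl -sumr_const -(eq_bigr _ count) -natr_sum.
congr (_%:R); rewrite mulnC -sum_nat_const.
transitivity (\sum_(p in S) \sum_(C in Xa | C \in porbit p @: D) 1)%N.
  apply: eq_bigr => p; rewrite inE => /andP[pD /asboolP ->].
  rewrite -sum1_card; apply: eq_bigl => C; rewrite !inE.
  apply/andP/andP => [[Cp Ca]|[/andP[_ Ca] Cp]]; split=> //; rewrite Ca andbT.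
  by case/imsetP: Cp => x xD ->; exact: porbit_sub.
rewrite (exchange_big_dep (mem Xa)) /=; last by move=> p C _ /andP[].
apply: eq_bigr => C CX; rewrite -sum1_card.
by apply: eq_bigl => p; rewrite [RHS]inE CX.
Qed.

Lemma sum_has_colors X A :
  finset.set0 \notin X -> has_colors X A ->
  \sum_(a <- finsupp A) val a *+ A a = \sum_(C in X) content C.
Proof.
move=> X0 XA.
transitivity (\sum_(a <- finsupp A) \sum_(C in X | content C == val a) content C).
  apply: eq_bigr => a _; rewrite (eq_bigr (fun=> val a)) => [|C /andP[_ /eqP//]].
  rewrite sumr_const XA; congr (_ *+ _); apply: eq_card => C.
  by rewrite inE.
rewrite (exchange_big_dep (mem X)) //=; last by move=> a C _ /andP[].
apply: eq_bigr => C CX.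
have C0 : content C != 0 by rewrite color_content_eq0; apply: contraNneq X0 => <-.
pose a : mindex_nz q := Sub (content C) C0.
have aA : a \in finsupp A.
  rewrite mem_finsupp XA -lt0n; apply/card_gt0P; exists C.
  by rewrite inE CX /=.
rewrite big_mkcond (big_fsetD1 a) //= CX eqxx /= big_seq big1 ?addr0 // => b.
rewrite !inE => /andP[ba _].
by rewrite -[content C]/(val a) (inj_eq val_inj) eq_sym (negPf ba).
Qed.

Lemma sum_content_partition X D :
  finset.partition X D -> \sum_(C in X) content C = content D.
Proof.
move=> /and3P[/eqP <- tX _]; apply/ffunP=> j; rewrite sum_ffunE ffunE.
have cardE C : #|[set i in C | c i == j]| = (\sum_(i in C) (c i == j))%N.
  by rewrite -sum1dep_card big_mkcondr.
rewrite cardE (eq_bigr (fun C => \sum_(i in C) (c i == j))%N) => [|C _].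
  by apply/esym; exact: big_trivIset.
by rewrite ffunE cardE.
Qed.

(** The cycles of p partition the points, so their contents add up to the
    content of all points. *)
Lemma color_partition (p : {perm 'I_(mabs n)}) :
  chromatic_partitions (content [set: 'I_(mabs n)]) (color c p).
Proof.
have part : finset.partition (porbits p) [set: 'I_(mabs n)].
  rewrite porbitsT porbitE orbit_partition //.
  by apply/actsP=> g _ x; rewrite !finset.in_setT.
rewrite /chromatic_partitions (@sum_has_colors (porbits p)).
- exact: sum_content_partition.
- by case/and3P: part.
- exact/color_eq.
Qed.

End Coloring.

Theorem proposition3p15 (R : realType) (q k : nat) (hq : (0 < q)%N)
    (hk : (0 < k)%N) (n : {ffun 'I_q -> nat})
    (c : {ffun 'I_(mabs n) -> 'I_q}) (hc : is_coloring c)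
    (s : 'I_q -> 'cV[R]_k) (alpha : 'cV[R]_k) :
  let S : 'M[R]_(k, q) := \matrix_(i < k, j < q) s j i 0 in
  pattern_inventory c S alpha = cycle_index n (Omega S alpha n) /\
  cycle_index n (Omega S alpha n) =
    (mabs n)`!%:R^-1 *
    \sum_(A \in chromatic_partitions n)
      chromatic_coef R n A *
      \prod_(a <- finsupp A)
        (dot (\big[@hadamard R k/const_mx 1]_(j < q)
                hadamard_exp (s j) (val a j)) alpha) ^+ A a.
Proof.
move=> S.
have omegaE a : omega S alpha a =
    dot (\big[@hadamard R k/const_mx 1]_(j < q) hadamard_exp (s j) (a j)) alpha.
  rewrite /omega; congr (dot _ _); apply: eq_bigr => j _; congr hadamard_exp.
  by apply/matrixP=> i z; rewrite !mxE ord1.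
have cyE : cycle_index n (Omega S alpha n) = (mabs n)`!%:R^-1 *
    \sum_(A \in chromatic_partitions n) chromatic_coef R n A * weight S alpha A.
  rewrite /cycle_index; congr (_ * _); apply: eq_fsbigr => A /set_mem nA.
  rewrite /weight !big_seq; congr (_ * _); apply: eq_bigr => a aA.
  by rewrite (insubT (fun b => mle b n) (chromatic_partitions_mle nA aA)).
split; last first.
  rewrite cyE; congr (_ * _); apply: eq_fsbigr => A _; congr (_ * _).
  by apply: eq_bigr => a _; rewrite omegaE.
have nE : color_content c [set: 'I_(mabs n)] = n.
  by apply/ffunP=> j; rewrite ffunE -hc; apply: eq_card => i; rewrite !inE.
rewrite cyE /pattern_inventory; congr (_ * _).
have fin := chromatic_partitions_finite n.
rewrite fsbig_finite //=.
pose Ps := fset_set (chromatic_partitions n).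
(* M(A) is replaced by a sum of ones over the permutations of type A; each p is
   then met exactly once, at A = color p. *)
rewrite (eq_big_seq (fun A => \sum_(p | color c p == A) weight S alpha A)) => [|A].
  rewrite (exchange_big_dep predT) //=; apply: eq_bigr => p _.
  have pP : color c p \in Ps.
    by rewrite in_fset_set // mem_set //; have := color_partition c p; rewrite nE.
  rewrite big_mkcond (big_fsetD1 _ pP) eqxx big_seq /= big1 ?addr0 // => A.
  by rewrite !inE eq_sym => /andP[/negPf->].
rewrite in_fset_set // => /set_mem AP.
have := @card_colored_perms _ _ c R [set: 'I_(mabs n)] A; rewrite nE => /(_ AP) E.
rewrite sumr_const -mulr_natl -E; congr (_%:R * _); apply: eq_card => p.
rewrite -[RHS]/(color c p == A) !inE -porbitsT.
apply/andP/eqP => [[_ /asboolP/color_eq]//|/color_eq pA].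
by split; [apply/fintype.subsetP=> x _; rewrite inE | exact/asboolP].
Qed.
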